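(* Let $F$ be a field, let $A$ be a unital associative $F$-algebra, and let $V$ be a finite dimensional irreducible $A$-module. Then $V$ is zero action determined (zad) if and only if $\dim V > \dim \operatorname{End}_A(V)$ or $\dim \operatorname{End}_A(V) = 1$.
   Context: All algebras are unital associative algebras over the fixed field $F$ (possibly infinite dimensional) and all modules are unital left modules; $\dim$ means dimension over $F$. An $A$-module $V$ is called zero action determined (zad) if for every $F$-bilinear map $f: A\times V\to F$ with the property that $f(a,m)=0$ whenever $a\in A$, $m\in V$ and $am=0$, there exists a linear map $\Phi: V\to F$ such that $f(x,v)=\Phi(xv)$ for all $x\in A$, $v\in V$. $\operatorname{End}_A(V)$ is the algebra of $A$-module endomorphisms of $V$. *)

(* Defs.v *)
From HB Require Import structures.
From mathcomp Require Import all_boot all_order all_algebra.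
From mathcomp Require Import boolp classical_sets.

Set Implicit Arguments.
Unset Strict Implicit.
Unset Printing Implicit Defensive.

Import GRing.Theory VectorInternalTheory.
Local Open Scope ring_scope.

(* A unital left module over the F-algebra A is an [lmodType A].  It is an
   F-vector space through F -> A, k |-> k%:A; since MathComp allows only one
   [lmodType] structure per carrier, the F-space lives on the alias [resF V],
   which is convertible to V. *)
Definition resF (F : fieldType) (A : algType F) (V : lmodType A) : Type := V.

Section RestrictionOfScalars.
Variables (F : fieldType) (A : algType F) (V : lmodType A).

HB.instance Definition _ := GRing.Zmodule.on (resF V).

Definition resF_scale (k : F) (v : resF V) : resF V := (k%:A : A) *: (v : V).

Fact resF_scaleA a b v : resF_scale a (resF_scale b v) = resF_scale (a * b) v.
Proof. by rewrite /resF_scale scalerA -scalerAl mul1r scalerA. Qed.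

Fact resF_scale1 : left_id 1 resF_scale.
Proof. by move=> v; rewrite /resF_scale !scale1r. Qed.

Fact resF_scaleDr : right_distributive resF_scale +%R.
Proof. by move=> k u v; rewrite /resF_scale scalerDr. Qed.

Fact resF_scaleDl v : {morph resF_scale^~ v : a b / a + b}.
Proof. by move=> a b; rewrite /resF_scale !scalerDl. Qed.

HB.instance Definition _ := GRing.Zmodule_isLmodule.Build F (resF V)
  resF_scaleA resF_scale1 resF_scaleDr resF_scaleDl.

Lemma resF_scaleE (k : F) (v : resF V) : k *: v = (k%:A : A) *: (v : V).
Proof. by []. Qed.

End RestrictionOfScalars.

(* The carrier of End_A(V), as an F-space under pointwise operations. *)
Definition endA (F : fieldType) (A : algType F) (V : lmodType A) : Type :=
  {linear V -> V}.

HB.instance Definition _ (F : fieldType) (A : algType F) (V : lmodType A) :=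
  gen_eqMixin (endA V).
HB.instance Definition _ (F : fieldType) (A : algType F) (V : lmodType A) :=
  gen_choiceMixin (endA V).

Section Endomorphisms.
Variables (F : fieldType) (A : algType F) (V : lmodType A).
Implicit Types f g h : endA V.

Definition endA_fun f : V -> V := (f : {linear V -> V}).

Lemma endAP f g : endA_fun f =1 endA_fun g -> f = g.
Proof.
case: f g => [f [[f1] [f2]]] [g [[g1] [g2]]]; rewrite /endA_fun /= => /funext E.
case: _ / E in g1 g2 *.
by rewrite (Prop_irrelevance g1 f1) (Prop_irrelevance g2 f2).
Qed.

Definition endA_zero : endA V := (\0%R : {linear V -> V}).
Definition endA_add f g : endA V :=
  ((f : {linear V -> V}) \+ (g : {linear V -> V}) : {linear V -> V}).
Definition endA_opp f : endA V := (\- (f : {linear V -> V}) : {linear V -> V}).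

Definition endA_scale_fun (k : F) f (v : V) : V := (k%:A : A) *: endA_fun f v.

Fact endA_scale_fun_is_linear k f : linear (endA_scale_fun k f).
Proof.
move=> a u v; rewrite /endA_scale_fun /endA_fun linearP scalerDr !scalerA.
by rewrite -scalerAl mul1r -scalerAr mulr1.
Qed.

HB.instance Definition _ k f := GRing.isLinear.Build A V V *:%R
  (endA_scale_fun k f) (endA_scale_fun_is_linear k f).

Definition endA_scale k f : endA V := (endA_scale_fun k f : {linear V -> V}).

Fact endA_addA : associative endA_add.
Proof. by move=> f g h; apply: endAP => v; apply: addrA. Qed.
Fact endA_addC : commutative endA_add.
Proof. by move=> f g; apply: endAP => v; apply: addrC. Qed.
Fact endA_add0 : left_id endA_zero endA_add.
Proof. by move=> f; apply: endAP => v; apply: add0r. Qed.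
Fact endA_addN : left_inverse endA_zero endA_opp endA_add.
Proof. by move=> f; apply: endAP => v; apply: addNr. Qed.

HB.instance Definition _ := GRing.isZmodule.Build (endA V)
  endA_addA endA_addC endA_add0 endA_addN.

Fact endA_scaleA a b f : endA_scale a (endA_scale b f) = endA_scale (a * b) f.
Proof. by apply: endAP => v; apply: (@resF_scaleA _ _ V). Qed.
Fact endA_scale1 : left_id 1 endA_scale.
Proof. by move=> f; apply: endAP => v; apply: (@resF_scale1 _ _ V). Qed.
Fact endA_scaleDr : right_distributive endA_scale +%R.
Proof. by move=> k f g; apply: endAP => v; apply: (@resF_scaleDr _ _ V). Qed.
Fact endA_scaleDl f : {morph endA_scale^~ f : a b / a + b}.
Proof. by move=> a b; apply: endAP => v; apply: (@resF_scaleDl _ _ V). Qed.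

HB.instance Definition _ := GRing.Zmodule_isLmodule.Build F (endA V)
  endA_scaleA endA_scale1 endA_scaleDr endA_scaleDl.

Lemma endA_addE f g v : endA_fun (f + g) v = endA_fun f v + endA_fun g v.
Proof. by []. Qed.
Lemma endA_scaleE k f v : endA_fun (k *: f) v = (k%:A : A) *: endA_fun f v.
Proof. by []. Qed.

End Endomorphisms.

(* [Vector.axiom n W] is the type of F-linear bijections W -> 'rV[F]_n. *)
Definition has_dim (F : fieldType) (W : lmodType F) (n : nat) : Prop :=
  inhabited (Vector.axiom n W).

Definition finite_dim (F : fieldType) (W : lmodType F) : Prop :=
  exists n, has_dim W n.

(* The value is the junk 0 on infinite dimensional spaces. *)
Definition dimF (F : fieldType) (W : lmodType F) : nat :=
  xget 0%N [set n | has_dim W n]%classic.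

Definition irreducible_module (A : nzRingType) (V : lmodType A) : Prop :=
  (exists v : V, v != 0) /\
  forall S : {pred V}, GRing.submod_closed S ->
    (forall v, v \in S -> v = 0) \/ (forall v, v \in S).

Definition zad (F : fieldType) (A : algType F) (V : lmodType A) : Prop :=
  forall f : {bilinear A -> resF V -> F | *%R & *%R},
    (forall (a : A) (m : V), a *: m = 0 -> f a m = 0) ->
    exists Phi : {scalar resF V}, forall (x : A) (v : V), f x v = Phi (x *: v).

(* No junk enters the use made of [dimF]: dimension is unique, and End_A(V) is
   finite dimensional as soon as V is. *)

Lemma has_dim_inj (F : fieldType) (W : lmodType F) m n :
  has_dim W m -> has_dim W n -> m = n.
Proof.
have le p q : has_dim W p -> has_dim W q -> (p <= q)%N.
  case=> -[r lr [s rK sK]] [[r' lr' [s' rK' sK']]].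
  have ls : linear (r' \o s).
    move=> a u v /=; rewrite -lr' /=; congr r'.
    by apply: (can_inj rK); rewrite lr !sK.
  pose hs := GRing.isLinear.Build _ _ _ _ (r' \o s) ls.
  pose L : {linear 'rV[F]_p -> 'rV[F]_q} := HB.pack (r' \o s) hs.
  suff /eqP <- : row_free (lin1_mx L) by apply: rank_leq_col.
  apply: inj_row_free => v; rewrite mul_rV_lin1 -(linear0 L) /L /=.
  by move/(can_inj rK')/(can_inj sK).
by move=> hm hn; apply/eqP; rewrite eqn_leq !le.
Qed.

Lemma dimF_eq (F : fieldType) (W : lmodType F) n : has_dim W n -> dimF W = n.
Proof.
move=> hn; rewrite /dimF; case: xgetP => [m _ hm|/(_ n)//].
exact: has_dim_inj hm hn.
Qed.

Lemma finite_dim_inj (F : fieldType) (W : lmodType F) (U : vectType F)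
    (g : {linear W -> U}) : injective g -> finite_dim W.
Proof.
move=> g_inj.
pose P (d : nat) := `[< exists X : {vspace U}, \dim X = d /\
                 forall u, u \in X -> exists w, g w = u >].
have P0 : exists d, P d.
  exists 0%N; apply/asboolP; exists 0%VS; split; first by rewrite dimv0.
  by move=> u; rewrite memv0 => /eqP ->; exists 0; rewrite linear0.
have Pb d : P d -> (d <= dim U)%N.
  by move=> /asboolP[X [<- _]]; rewrite -dimvf dimvS ?subvf.
case: (ex_maxnP P0 Pb) => d /asboolP[X [dX Xg]] dmax.
have gX w : g w \in X.
  apply/negPn/negP => gwX.
  have : (\dim (X + <[g w]>) <= d)%N.
    apply: dmax; apply/asboolP; eexists; split; first by [].
    move=> u /memv_addP[x xX [y /vlineP[k ->] ->]].
    by have [w' <-] := Xg _ xX; exists (w' + k *: w); rewrite linearD linearZ.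
  rewrite -dX => le; move/negP: gwX; apply.
  have /eqP -> : (X == X + <[g w]>)%VS by rewrite eqEdim addvSl le.
  by rewrite (subvP (addvSr _ _)) ?memv_line.
have Y (y : subvs_of X) : {w | g w = vsval y} by apply/cid/Xg/subvsP.
exists (dim (subvs_of X)); constructor.
exists (fun w => v2r (vsproj X (g w))).
  by move=> a u v; rewrite !linearP.
exists (fun r => sval (Y (r2v r))) => [w|r].
  by case: (Y _) => w' /=; rewrite v2rK vsprojK // => /g_inj.
by case: (Y _) => w' /= ->; rewrite vsvalK r2vK.
Qed.

Lemma finite_dim_endA (F : fieldType) (A : algType F) (V : lmodType A) :
  finite_dim (resF V) -> finite_dim (endA V).
Proof.
case=> n [[r lr [s rK sK]]].
have ls : linear s.
  by move=> a u v; apply: (can_inj rK); rewrite lr !sK.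
pose hr := GRing.isLinear.Build _ _ _ _ r lr.
pose R : {linear resF V -> 'rV[F]_n} := HB.pack r hr.
pose hs := GRing.isLinear.Build _ _ _ _ s ls.
pose S : {linear 'rV[F]_n -> resF V} := HB.pack s hs.
pose h (f : endA V) (v : resF V) : resF V := endA_fun f v.
pose g (f : endA V) : 'M[F]_n := \matrix_i r (h f (s (row i 1%:M))).
have lg : linear g.
  move=> a f1 f2; apply/row_matrixP => i; rewrite linearP /= !rowK.
  by rewrite -lr.
have lh f : linear (h f).
  by move=> a u v; rewrite /h /endA_fun !resF_scaleE linearP.
have gE f v : r (h f (s v)) = v *m g f.
  have lq : linear (fun v => r (h f (s v))).
    by move=> a u w /=; rewrite ls lh lr.
  pose hq := GRing.isLinear.Build _ _ _ _ _ lq.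
  pose Q : {linear 'rV[F]_n -> 'rV[F]_n} := HB.pack (fun v => r (h f (s v))) hq.
  rewrite -[LHS]/(Q v) {1}[v]row_sum_delta linear_sum mulmx_sum_row.
  by apply: eq_bigr => i _; rewrite linearZ /= rowK rowE mulmx1.
pose hg := GRing.isLinear.Build _ _ _ _ g lg.
pose G : {linear endA V -> 'M[F]_n} := HB.pack g hg.
apply: (@finite_dim_inj _ _ _ G) => f1 f2 E; apply: endAP => v.
have := gE f1 (r v); rewrite (E : g f1 = g f2) -gE rK.
exact: (can_inj rK).
Qed.

(* Main.v *)
Require Import Defs.
From HB Require Import structures.
From mathcomp Require Import all_boot all_order all_algebra.
From mathcomp Require Import boolp.

(** Put [D = End_A(V)]; the proof compares [V] with the orbit [D v] of a nonzero
    vector [v].  Evaluation at [v] embeds [D] in [V], because an endomorphism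
    killing [v] kills [A v = V].  Hence [dim D < dim V] means that [D v] is
    always a proper subspace, and otherwise [D v = V].

    A vector [w] lies in [D v] exactly when every scalar killing [v] also kills
    [w]: then [a v |-> a w] is a well defined endomorphism ([endA_extends]).
    Outside of this situation, simplicity provides the instance of Jacobson
    density for two vectors that is needed here: some [a] kills [v] and sends
    [w] to any prescribed vector ([density2]).

    Suppose [dim D < dim V], and let [f] be a bilinear map vanishing on zero
    actions.  Then [f a u] depends only on [u] and [a u], and the claim is that
    it does not depend on [u] either ([zero_action_value_eq]).  If neither of
    [u], [w] lies in the [D]-orbit of the other, density yields [c] and [e] with
    [c u = t], [c w = 0], [e u = 0], [e w = t]; as [c] and [e] agree on [u + w],
    expanding [f c (u + w) = f e (u + w)] gives [f c u = f e w].  If [w] lies in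
    [D u], both are compared with a third vector outside of [D u].  So
    [f a v = f 1 (a v)], and [f 1] is the required functional.  When
    [dim D = 1 = dim V] every scalar acts on [V] as an element of [F] and the
    same identity is immediate.

    Suppose [dim V <= dim D], so that [D v = V].  Then a scalar killing one
    nonzero vector kills all of [V], so [f a w = phi (a v) * phi w] vanishes on
    zero actions for every functional [phi].  If [dim V > 1], choose [phi]
    nonzero with [phi v = 0]: a functional inducing [f] would be [f 1 = 0],
    whereas [f] is not zero because [A v = V].  Hence a zad module has
    [dim D <= dim V <= 1], and [dim D = 1] since [dim D >= dim V > 0]. *)

Set Implicit Arguments.
Unset Strict Implicit.
Unset Printing Implicit Defensive.

Import GRing.Theory.
Local Open Scope ring_scope.

(** * Dimension and linear maps *)

Section Dimension.
Variable F : fieldType.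

Lemma coord0 (W : lmodType F) n (c : Vector.axiom n W) : s2val c 0 = 0.
Proof. by case: c => r lr _ /=; have := lr (-1) 0 0; rewrite !scaleN1r !addNr. Qed.

(** Reduces every comparison of dimensions below to the rank of a matrix. *)
Lemma linear_matrix (W U : lmodType F) m n (g : {linear W -> U})
    (cW : Vector.axiom m W) (cU : Vector.axiom n U) :
  exists2 G : 'M[F]_(m, n), forall w, s2val cU (g w) = s2val cW w *m G
    & injective g -> row_free G.
Proof.
have := (coord0 cW, coord0 cU).
case: cW cU => [r lr [s rK sK]] [q lq [q' qK _]] /= [r0 q0].
have ls : linear s by move=> a u v; apply: (can_inj rK); rewrite lr !sK.
have lh : linear (fun x => q (g (s x))).
  by move=> a u v /=; rewrite ls linearP lq.
pose hh := GRing.isLinear.Build _ _ _ _ _ lh.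
pose h : {linear 'rV[F]_m -> 'rV[F]_n} := HB.pack (fun x => q (g (s x))) hh.
exists (lin1_mx h) => [w|gI]; first by rewrite mul_rV_lin1 /= rK.
apply: inj_row_free => x; rewrite mul_rV_lin1 /= -q0 => /(can_inj qK) gx0.
by rewrite -[x]sK -r0; congr r; apply: gI; rewrite gx0 linear0.
Qed.

Lemma has_dim_surj (W U : lmodType F) m n (g : {linear W -> U}) :
  has_dim W m -> has_dim U n -> (forall u, exists w, g w = u) -> (n <= m)%N.
Proof.
move=> [cW] [cU] gS; have [G GE _] := linear_matrix g cW cU.
case: cU GE => q lq [q' qK q'K] /= GE.
suff /eqP <- : row_full G by apply: rank_leq_row.
rewrite -sub1mx; apply/row_subP => i.
by have [w gw] := gS (q' (row i 1%:M)); rewrite -[row _ _]q'K -gw GE submxMl.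
Qed.

Lemma has_dim_inj_leq (W U : lmodType F) m n (g : {linear W -> U}) :
  has_dim W m -> has_dim U n -> injective g -> (m <= n)%N.
Proof.
move=> [cW] [cU] gI; have [G _ /(_ gI)/eqP <-] := linear_matrix g cW cU.
exact: rank_leq_col.
Qed.

Lemma has_dim_inj_surj (W U : lmodType F) m n (g : {linear W -> U}) :
  has_dim W m -> has_dim U n -> (n <= m)%N -> injective g ->
  forall u, exists w, g w = u.
Proof.
move=> [cW] [cU] le_nm gI u; have [G GE /(_ gI) freeG] := linear_matrix g cW cU.
case: cW cU GE => [r lr [s rK sK]] [q lq [q' qK q'K]] /= GE.
have fullG : row_full G.
  by rewrite /row_full eqn_leq rank_leq_col (eqP (freeG : \rank G == m)).
have [x xG] := submxP (submx_full (q u) fullG).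
by exists (s x); apply: (can_inj qK); rewrite GE sK -xG.
Qed.

Lemma has_dim_gt0 (W : lmodType F) n (u : W) :
  has_dim W n -> u != 0 -> (0 < n)%N.
Proof.
case: n => // -[c] /eqP[]; have := coord0 c.
case: c => r lr [s rK sK] /= r0; apply: (can_inj rK).
by rewrite r0 [LHS]thinmx0.
Qed.

Lemma functional_vanishing_at (W : lmodType F) n (v : W) :
  has_dim W n -> (1 < n)%N ->
  exists phi : {scalar W}, phi v = 0 /\ exists w, phi w != 0.
Proof.
case=> -[r lr [s rK sK]] n1; pose K := cokermx (r v).
have K0 : K != 0.
  rewrite -mxrank_eq0 mxrank_coker subn_eq0 -ltnNge.
  exact: leq_ltn_trans (rank_leq_row _) n1.
have [i [j Kij]] : exists i j, K i j != 0.
  apply: contrapT => noK; case/eqP: K0; apply/matrixP => i j; rewrite [RHS]mxE.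
  by apply/eqP/negPn/negP => Kij; apply: noK; exists i, j.
have lphi : scalar (fun w => (r w *m K) 0 j).
  by move=> a u w /=; rewrite lr mulmxDl -scalemxAl !mxE.
pose hphi := GRing.isLinear.Build _ _ _ _ _ lphi.
pose phi : {scalar W} := HB.pack (fun w => (r w *m K) 0 j) hphi.
exists phi; split; first by rewrite /phi /= mulmx_coker mxE.
by exists (s (delta_mx 0 i)); rewrite /phi /= sK -rowE mxE.
Qed.

Lemma dim1_collinear (W : lmodType F) n (u v : W) :
  has_dim W n -> (n <= 1)%N -> u != 0 -> exists c, v = c *: u.
Proof.
case=> c n1 u0; have := coord0 c; case: c => r lr [s rK sK] /= r0.
have ru0 : r u != 0 by apply: contra u0 => /eqP ru; rewrite -[u]rK ru -r0 rK.
have full : row_full (r u).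
  by rewrite /row_full eqn_leq rank_leq_col (leq_trans n1) // lt0n mxrank_eq0.
have [x vx] := submxP (submx_full (r v) full).
have lrZ c w : r (c *: w) = c *: r w by rewrite -[c *: w]addr0 lr r0 addr0.
by exists (x 0 0); apply: (can_inj rK); rewrite vx [x]mx11_scalar mul_scalar_mx lrZ mxE.
Qed.

End Dimension.

(** * Irreducible modules *)

Section Irreducible.
Variables (F : fieldType) (A : algType F) (V : lmodType A).
Hypothesis hirr : irreducible_module V.
Implicit Types (a b c : A) (u v w t : V).

Lemma submodule_full (P : V -> Prop) :
  P 0 -> (forall a u v, P u -> P v -> P (a *: u + v)) ->
  (exists2 v, P v & v != 0) -> forall v, P v.
Proof.
move=> P0 PD [w Pw w0] v; pose S : {pred V} := fun v => `[< P v >].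
have SP u : u \in S <-> P u by split => [/asboolP|/asboolP].
have [|all0|all] := hirr.2 S; last by apply/SP.
  split; first by apply/SP.
  by move=> a u1 u2 /SP P1 /SP P2; apply/SP/PD.
by case/eqP: w0; apply/all0/SP.
Qed.

Lemma irreducible_generator u : u != 0 -> forall v, exists a, a *: u = v.
Proof.
move=> u0; apply: submodule_full.
- by exists 0; rewrite scale0r.
- by move=> a _ _ [b <-] [c <-]; exists (a * b + c); rewrite scalerDl scalerA.
- by exists u => //; exists 1; rewrite scale1r.
Qed.

Definition ann_sub u w := forall a, a *: u = 0 -> a *: w = 0.

(** The annihilator of a nonzero vector is a maximal left ideal, so there are
    no proper inclusions between such annihilators. *)
Lemma ann_sub_sym u w : w != 0 -> ann_sub u w -> ann_sub w u.
Proof.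
move=> w0 uw a aw0; apply/eqP/negPn/negP => au0.
have [b bau] := irreducible_generator au0 u.
have : (1 - b * a) *: w = 0.
  by apply: uw; rewrite scalerBl scale1r -scalerA bau subrr.
rewrite scalerBl scale1r -scalerA aw0 scaler0 subr0.
exact/eqP.
Qed.

(** The vectors [c w], for [c] killing [u], form a submodule, and it is nonzero
    because some such [c] does not kill [w]. *)
Lemma density2 u w : ~ ann_sub u w -> forall t, exists2 c, c *: u = 0 & c *: w = t.
Proof.
move=> nuw; apply: submodule_full.
- by exists 0; rewrite scale0r.
- move=> a _ _ [b bu <-] [c cu <-]; exists (a * b + c).
    by rewrite scalerDl -scalerA bu cu scaler0 addr0.
  by rewrite scalerDl scalerA.
- apply: contrapT => no; apply: nuw => a au0; apply/eqP/negPn/negP => aw0.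
  by apply: no; exists (a *: w) => //; exists a.
Qed.

(** The endomorphism is [a u |-> a w]; the inclusion of annihilators is what
    makes it well defined, and [A u = V] what makes it total. *)
Lemma endA_extends u w :
  u != 0 -> ann_sub u w -> exists d : endA V, endA_fun d u = w.
Proof.
move=> u0 uw.
have uwE a b : a *: u = b *: u -> a *: w = b *: w.
  move=> ab; apply/eqP; rewrite -subr_eq0 -scalerBl; apply/eqP/uw.
  by rewrite scalerBl ab subrr.
have X v : {a | a *: u = v} by apply/cid/irreducible_generator.
pose g v := sval (X v) *: w.
have gE a : g (a *: u) = a *: w by apply: uwE; apply: svalP (X (a *: u)).
have lg : linear g.
  move=> a v1 v2; have [b <-] := X v1; have [c <-] := X v2.
  by rewrite scalerA -scalerDl !gE scalerDl scalerA.
pose hg := GRing.isLinear.Build _ _ _ _ g lg.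
pose d : {linear V -> V} := HB.pack g hg.
by exists (d : endA V); rewrite /endA_fun /= -{1}[u]scale1r gE scale1r.
Qed.

Definition endA_eval u (d : endA V) : resF V := endA_fun d u.

Fact endA_eval_is_linear u : linear (endA_eval u).
Proof. by []. Qed.

HB.instance Definition _ u := GRing.isLinear.Build F (endA V) (resF V) *:%R
  (endA_eval u) (endA_eval_is_linear u).

Lemma endA_eval_inj u : u != 0 -> injective (endA_eval u).
Proof.
move=> u0 d e de; apply: endAP => v.
have [a <-] := irreducible_generator u0 v.
by rewrite /endA_fun !linearZ; congr (_ *: _).
Qed.

Lemma scale_algE (k : F) a v : (k *: a) *: v = k%:A *: (a *: v).
Proof. by rewrite scalerA -scalerAl mul1r. Qed.

(** * Bilinear maps vanishing on zero actions *)

Section ZeroActionVanishing.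
Variable f : {bilinear A -> resF V -> F | *%R & *%R}.
Hypothesis f0 : forall a (m : V), a *: m = 0 -> f a m = 0.

Lemma zero_action_congr a b u : a *: u = b *: u -> f a u = f b u.
Proof.
move=> ab; apply/eqP; rewrite -subr_eq0 -linearBl; apply/eqP/f0.
by rewrite scalerBl ab subrr.
Qed.

Lemma zero_action_value_indep a b u w :
  ~ ann_sub u w -> ~ ann_sub w u -> a *: u = b *: w -> f a u = f b w.
Proof.
move=> nuw nwu ab.
have [c cw cu] := density2 nwu (a *: u).
have [e eu ew] := density2 nuw (a *: u).
have ce : f c (u + w : V) = f e (u + w : V).
  by apply: zero_action_congr; rewrite !scalerDr cw cu eu ew addr0 add0r.
rewrite (zero_action_congr (esym cu)) (zero_action_congr (_ : b *: w = e *: w)).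
  by move: ce; rewrite !(linearDr f) (f0 cw) (f0 eu) addr0 add0r.
by rewrite ew.
Qed.

(** The hypothesis on [z] says that the orbit of a nonzero vector under
    [End_A(V)] is never the whole space.  When [u] and [w] lie in the same orbit,
    no scalar kills one and not the other, so density does not separate them;
    it does separate each of them from a vector [z] outside of the orbit. *)
Lemma zero_action_value_eq a b u w :
  (forall u, u != 0 -> exists z, ~ ann_sub u z) ->
  u != 0 -> w != 0 -> a *: u = b *: w -> f a u = f b w.
Proof.
move=> out u0 w0 ab.
have [uw|nuw] := pselect (ann_sub u w); last first.
  by apply: zero_action_value_indep => // wu; apply/nuw/ann_sub_sym.
have wu : ann_sub w u by apply: ann_sub_sym.
have [z nuz] := out u u0.
have nwz : ~ ann_sub w z by move=> wz; apply: nuz => c /uw/wz.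
have z0 : z != 0 by apply/eqP => z0; apply: nuz => c _; rewrite z0 scaler0.
have [c cz] := irreducible_generator z0 (a *: u).
rewrite (@zero_action_value_indep a c u z) //.
- apply: zero_action_value_indep; [|by []|by rewrite cz].
  by move=> zw; apply/nwz/ann_sub_sym.
- by move=> zu; apply/nuz/ann_sub_sym.
Qed.

End ZeroActionVanishing.

(** Taking [x = 1] in [f x v = Phi (x *: v)] leaves no choice for [Phi]. *)
Lemma zad_unit_criterion :
  (forall f : {bilinear A -> resF V -> F | *%R & *%R},
     (forall a (m : V), a *: m = 0 -> f a m = 0) ->
     forall a v, f a v = f 1 (a *: v)) -> zad V.
Proof.
move=> fE f f0.
have lPhi : scalar (fun v : resF V => f 1 v) by move=> k u v; rewrite linearPr.
pose hPhi := GRing.isLinear.Build _ _ _ _ _ lPhi.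
pose Phi : {scalar resF V} := HB.pack (fun v : resF V => f 1 v) hPhi.
by exists Phi => a v; apply: fE.
Qed.

Lemma zad_of_proper_orbits :
  (forall u, u != 0 -> exists z, ~ ann_sub u z) -> zad V.
Proof.
move=> out; apply: zad_unit_criterion => f f0 a v.
have [av0|av0] := eqVneq (a *: v) 0; first by rewrite av0 linear0r f0.
have v0 : v != 0 by apply: contra av0 => /eqP ->; rewrite scaler0.
by apply: zero_action_value_eq => //; rewrite scale1r.
Qed.

Lemma zad_of_collinear :
  (forall u v : resF V, u != 0 -> exists k, v = k *: u) -> zad V.
Proof.
move=> col; apply: zad_unit_criterion => f f0 a v.
have [->|v0] := eqVneq v 0; first by rewrite scaler0 !linear0r.
have [k avk] := col v (a *: v) v0.
rewrite [in RHS]avk linearZr /= -linearZl_LR.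
by apply: zero_action_congr => //; rewrite avk.
Qed.

(** The form [(a, m) |-> phi (a v) * phi m] vanishes on zero actions because
    nonzero elements of [End_A(V)] are invertible: if [a (d v) = d (a v) = 0] and
    [a v] is nonzero, then [d = 0]. *)
Lemma not_zad_of_full_orbit v (phi : {scalar resF V}) :
  v != 0 -> (forall w, exists d : endA V, endA_fun d v = w) ->
  phi v = 0 -> (exists w, phi w != 0) -> ~ zad V.
Proof.
move=> v0 orb phiv [w phiw] zV.
pose g a (m : resF V) : F := phi (a *: v) * phi m.
have gl m : scalar (g^~ m).
  move=> k a b; rewrite /g scalerDl scale_algE.
  by rewrite -[k%:A *: _]/(k *: (a *: v : resF V)) linearP mulrDl mulrA.
have gr a : scalar (g a).
  by move=> k x y; rewrite /g linearP mulrDr mulrCA.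
pose hg := bilinear_isBilinear.Build _ _ _ _ _ _ g (gl, gr).
pose f : {bilinear A -> resF V -> F | *%R & *%R} := HB.pack g hg.
have f0 a (m : V) : a *: m = 0 -> f a m = 0.
  move=> am0; rewrite /f /= /g.
  have [->|m0] := eqVneq m 0; first by rewrite linear0 mulr0.
  have [d dv] := orb m.
  suff -> : a *: v = 0 by rewrite linear0 mul0r.
  apply/eqP/negPn/negP => av0; case/eqP: m0.
  have [b bav] := irreducible_generator av0 v.
  have dZ c u : endA_fun d (c *: u) = c *: endA_fun d u by apply: linearZ.
  by rewrite -dv -{1}bav !dZ dv am0 scaler0.
have [Phi PhiE] := zV f f0.
have Phi0 x : Phi x = 0.
  by rewrite -[x](scale1r (x : V)) -PhiE /f /= /g scale1r phiv mul0r.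
have [a av] := irreducible_generator v0 w.
have := PhiE a w; rewrite Phi0 /f /= /g av => /eqP.
by rewrite mulf_eq0 (negPf phiw).
Qed.

End Irreducible.

Theorem theorem3p3 (F : fieldType) (A : algType F) (V : lmodType A)
    (hfin : finite_dim (resF V)) (hirr : irreducible_module V) :
  zad V <-> ((dimF (endA V) < dimF (resF V))%N \/ dimF (endA V) = 1%N).
Proof.
have [m hm] := finite_dim_endA hfin; have [n hn] := hfin.
rewrite (dimF_eq hm) (dimF_eq hn).
have [v v0] := hirr.1.
have zad_lt : (m < n)%N -> zad V.
  move=> ltmn; apply: zad_of_proper_orbits => // u u0.
  apply: contrapT => full; move: ltmn; rewrite ltnNge => /negP; apply.
  apply: (has_dim_surj (g := endA_eval u) hm hn) => z.
  apply: endA_extends => //; apply: contrapT => nz; apply: full; by exists z.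
split=> [zV|[//|m1]]; last first.
  have [/zad_lt//|lenm] := ltnP m n.
  apply: zad_of_collinear => // u w u0.
  by apply: dim1_collinear hn _ u0; rewrite -m1.
have [|lenm] := ltnP m n; [by left|right].
have orb w : exists d : endA V, endA_fun d v = w.
  exact: (has_dim_inj_surj (g := endA_eval v) hm hn lenm (endA_eval_inj hirr v0)).
have n1 : (n <= 1)%N.
  rewrite leqNgt; apply/negP => n2.
  have [phi [phiv phiw]] := functional_vanishing_at (v : resF V) hn n2.
  exact: not_zad_of_full_orbit v0 orb phiv phiw zV.
apply/eqP; rewrite eqn_leq (leq_trans _ n1); last first.
  exact: has_dim_inj_leq hm hn (endA_eval_inj hirr v0).
exact: leq_trans (has_dim_gt0 (u := v : resF V) hn v0) lenm.
Qed.
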